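(* Assume that $\Psi_p(\cdot,h):[t_0,t_f]\to\mathbb{R}_{++}$ is positive and measurable for all $p\in\mathcal{P}$ and all $h$ such that $(h,Q)\in\widetilde\Lambda$ for some $Q$. Also assume that the inverse demand function $\Theta=(\Theta_{ij})_{(i,j)\in\mathcal{W}}$ exists. Then a pair $(h^*,Q^* )\in\widetilde\Lambda$ is a dynamic user equilibrium with elastic demand if and only if $$\sum_{p\in\mathcal{P}}\int_{t_0}^{t_f}\Psi_p(t,h^* )\big(h_p(t)-h_p^*(t)\big)\,dt-\sum_{(i,j)\in\mathcal{W}}\Theta_{ij}[Q^*]\,(Q_{ij}-Q_{ij}^* )\ \ge\ 0\qquad\text{for all }(h,Q)\in\widetilde\Lambda .$$
   Context: Fix a time interval $[t_0,t_f]$ with $t_0<t_f$, a finite set $\mathcal{W}$ of origin-destination (O-D) pairs, and a finite set $\mathcal{P}$ of paths which is the disjoint union of the sets $\mathcal{P}_{ij}$ of paths connecting O-D pair $(i,j)\in\mathcal{W}$. $\mathbb{R}_+$ denotes the nonnegative reals, $\mathbb{R}_{++}$ the positive reals, and $L^2_+[t_0,t_f]$ the nonnegative functions in $L^2[t_0,t_f]$. A vector of path departure rates is $h=(h_p)_{p\in\mathcal{P}}\in(L^2_+[t_0,t_f])^{|\mathcal{P}|}$. The effective path delay operator is a given map $\Psi:(L^2_+[t_0,t_f])^{|\mathcal{P}|}\to(L^2_+[t_0,t_f])^{|\mathcal{P}|}$, $h\mapsto\Psi(h)=(\Psi_p(\cdot,h))_{p\in\mathcal{P}}$; $\Psi_p(t,h)$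 is the travel cost of departing at time $t$ along path $p$ under departure rates $h$. Standing assumption: each $\Psi_p(\cdot,h)$ is measurable, almost everywhere positive, and square integrable. The inverse demand function is a map $\Theta=(\Theta_{ij})_{(i,j)\in\mathcal{W}}:\mathbb{R}_+^{|\mathcal{W}|}\to\mathbb{R}_{++}^{|\mathcal{W}|}$, the inverse of the demand map $v\mapsto Q$ that gives the vector of O-D demands as a function of the vector of minimum O-D travel costs (each $\Theta_{ij}$ may depend on the whole vector $Q$). The feasible set is $$\widetilde\Lambda=\Big\{(h,Q):\ h\ge 0,\ \sum_{p\in\mathcal{P}_{ij}}\int_{t_0}^{t_f}h_p(t)\,dt=Q_{ij}\ \ \forall (i,j)\in\mathcal{W}\Big\}\subset(L^2[t_0,t_f])^{|\mathcal{P}|}\times\mathbb{R}^{|\mathcal{W}|}.$$ Definition: $(h^*,Q^* )\in\widetilde\Lambda$ is a dynamic user equilibrium with elastic demand if for all $(i,j)\in\mathcal{W}$ and all $p\in\mathcal{P}_{ij}$, for almost every $t\in[t_0,t_f]$: (1) $h^*_p(t)>0$ implies $\Psi_p(t,h^* )=\Theta_{ij}[Q^*]$; and (2) $\Psi_p(t,h^* )\ge\Theta_{ij}[Q^*]$. *)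

(* Defs.v *)
From HB Require Import structures.
From mathcomp Require Import all_boot all_order all_algebra.
From mathcomp Require Import all_classical all_reals all_analysis.

Set Implicit Arguments.
Unset Strict Implicit.
Unset Printing Implicit Defensive.

Import Order.TTheory GRing.Theory Num.Theory.
Import numFieldNormedType.Exports.

Local Open Scope classical_set_scope.
Local Open Scope ring_scope.

Notation leb R := (@lebesgue_measure R).

(* L^2[t0, tf]: elements are classes of square-integrable functions on R for
   the Lebesgue measure restricted to [t0, tf]. As this measure vanishes
   outside [t0, tf], values taken there are irrelevant. An element coerces to a
   representative R -> R; it is only ever used below inside integrals over
   [t0, tf] and almost-everywhere statements on [t0, tf]. *)
Definition L2 (R : realType) (t0 tf : R) :=
  LspaceType2 (mrestr (leb R) (measurable_itv `[t0, tf])).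

Section DynamicUserEquilibrium.
Context (R : realType) (t0 tf : R) (W P : finType).

Definition L2plus : set (P -> L2 t0 tf) :=
  [set h | forall p, \forall t \ae leb R, t \in `[t0, tf] -> 0 <= h p t].

Definition nneg_vec : set (W -> R) := [set Q | forall w, 0 <= Q w].

Definition pos_vec : set (W -> R) := [set v | forall w, 0 < v w].

(* [od p] is the O-D pair connected by [p]: the sets P_ij are the fibers of
   [od], which therefore partition the set of paths. *)
Definition feasible (od : P -> W) : set ((P -> L2 t0 tf) * (W -> R)) :=
  [set hQ | L2plus hQ.1 /\
    forall w, \sum_(p | od p == w) \int[leb R]_(t in `[t0, tf]) hQ.1 p t
              = hQ.2 w].

(* [Theta], with domain the nonnegative vectors, is the inverse of the demand
   map, with domain the set [V] of vectors of minimum O-D travel costs. *)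
Definition inverse_demand (V : set (W -> R)) (demand Theta : (W -> R) -> W -> R)
    : Prop :=
  [/\ set_fun V nneg_vec demand, set_fun nneg_vec V Theta,
      {in V, cancel demand Theta} & {in nneg_vec, cancel Theta demand}].

Definition elastic_due (od : P -> W) (Psi : (P -> L2 t0 tf) -> P -> L2 t0 tf)
    (Theta : (W -> R) -> W -> R) (h : P -> L2 t0 tf) (Q : W -> R) : Prop :=
  forall w p, od p = w ->
    \forall t \ae leb R, t \in `[t0, tf] ->
      (0 < h p t -> Psi h p t = Theta Q w) /\ Theta Q w <= Psi h p t.

End DynamicUserEquilibrium.

Arguments L2plus {R} t0 tf P.
Arguments nneg_vec R W : clear implicits.
Arguments pos_vec R W : clear implicits.
Arguments feasible {R} t0 tf {W P} od.

(* Main.v *)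
Require Import Defs.
From HB Require Import structures.
From mathcomp Require Import all_boot all_order all_algebra.
From mathcomp Require Import all_classical all_reals all_analysis.
From mathcomp Require Import measurable_realfun lra.

Set Implicit Arguments.
Unset Strict Implicit.
Unset Printing Implicit Defensive.

Import Order.TTheory GRing.Theory Num.Theory.
Import numFieldNormedType.Exports.

Local Open Scope classical_set_scope.
Local Open Scope ring_scope.

(** The demand constraints define [Q] from [h], so they can be substituted in
    the variational inequality: grouping the paths by O-D pair, its left-hand
    side becomes [\sum_p \int g p t * (h p t - hs p t)], where
    [g p t := Psi hs p t - Theta Qs (od p)] is the excess cost of path [p]
    ([vi_gap]), and [h] now ranges over all nonnegative departure rates. The
    equilibrium conditions say that [hs p] and [g p] are a.e. complementary:
    [0 <= g p], and [g p = 0] where [0 < hs p].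

    If they are complementary, every integrand is a.e. nonnegative: it vanishes
    where [0 < hs p], and it equals [g p t * h p t] where [hs p t = 0]
    ([vi_of_complementarity]).

    Conversely, fix a path [p] and change only the rate on [p], from [hs p] to
    [Num.max 0 (hs p - g p)], the pointwise projection of [hs p - g p] on the
    nonnegative reals. The step [hs p - Num.max 0 (hs p - g p)] is
    [Num.min (hs p) (g p)]; its sign is never opposite to that of [g p], so that
    [g p * Num.min (hs p) (g p)] is a.e. nonnegative, while the variational
    inequality bounds its integral by 0. Hence it vanishes a.e., and its zeros
    are exactly the points where complementarity holds
    ([projection_step_eq0], [complementarity_of_vi]). A single test function
    thus gives both equilibrium conditions at once. *)

(** * The projection step *)

Lemma projection_step_ge0 (R : realDomainType) (x g : R) :
  0 <= x -> 0 <= g * (x - Num.max 0 (x - g)).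
Proof. by move=> x0; case: (leP 0 (x - g)) => xg; nra. Qed.

(** The second factor is [Num.min x g]: a zero product with [g < 0] would force
    [Num.min x g = g] to vanish, and with [g > 0] it forces [x = 0]. *)
Lemma projection_step_eq0 (R : realDomainType) (x g : R) :
  0 <= x -> g * (x - Num.max 0 (x - g)) = 0 ->
  0 <= g /\ (0 < x -> g = 0).
Proof.
move=> x0; case: (leP 0 (x - g)) => xg /eqP; rewrite mulf_eq0.
  by case/orP => /eqP; split=> *; lra.
by case/orP => /eqP; split=> *; lra.
Qed.

(** * Functions with a finite L^p norm *)

Section Lfun_closure.
Context d (T : measurableType d) (R : realType).
Context (mu : {measure set T -> \bar R}).

Lemma Lfun_normr (p : \bar R) (f : T -> R) :
  f \in Lfun mu p -> Num.norm \o f \in Lfun mu p.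
Proof.
case/andP; rewrite !inE/= => mf finf; apply/andP; split.
  by rewrite inE/=; exact: measurableT_comp.
rewrite inE/= /finite_norm.
under [X in ('N[_]__[X])%E]eq_fun => x do rewrite -abse_EFin.
by rewrite Lnorm_abse.
Qed.

Lemma LfunB (p : \bar R) (f g : T -> R) : (1 <= p)%E ->
  f \in Lfun mu p -> g \in Lfun mu p -> (fun x => f x - g x) \in Lfun mu p.
Proof.
by move=> p1 Lf Lg; rewrite (_ : (fun x => _) = f - g)//; exact: rpredB.
Qed.

Lemma Lfun_max0 (p : \bar R) (f : T -> R) : (1 <= p)%E ->
  f \in Lfun mu p -> (fun x => Num.max 0 (f x)) \in Lfun mu p.
Proof.
move=> p1 Lf.
(* the positive part of y is (y + |y|) / 2 *)
rewrite (_ : (fun x => _) = 2^-1 *: f + 2^-1 *: (Num.norm \o f) ).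
  apply: rpredD; apply: rpredZ => //; exact: Lfun_normr.
apply/funext => x; rewrite -[RHS]/(2^-1 * f x + 2^-1 * `|f x|).
by case: (leP 0 (f x)) => fx; [rewrite ger0_norm | rewrite ltr0_norm]; lra.
Qed.

Lemma Lfun_cst_fin (r c : R) : (mu setT < +oo)%E -> cst c \in Lfun mu r%:E.
Proof.
move=> fmu; rewrite inE/=; apply/andP; split; rewrite inE//=.
rewrite /finite_norm unlock poweR_lty//.
rewrite (eq_integral (cst (`|c| `^ r)%:E))//.
by rewrite integral_cst//= lte_mul_pinfty// lee_fin powR_ge0.
Qed.

Lemma ae_eq_finite_norm (r : R) (f g : T -> R) :
  measurable_fun setT f -> measurable_fun setT g -> ae_eq mu setT f g ->
  finite_norm mu r%:E f -> finite_norm mu r%:E g.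
Proof.
move=> mf mg fg; rewrite /finite_norm unlock.
rewrite (ae_eq_integral (fun x => `|(EFin \o g) x| `^ r)%E)//.
- apply/measurable_EFinP/(@measurableT_comp _ _ _ _ _ _ (@powR R ^~ r)) => //.
  exact: measurableT_comp.
- apply/measurable_EFinP/(@measurableT_comp _ _ _ _ _ _ (@powR R ^~ r)) => //.
  exact: measurableT_comp.
- by apply: filterS fg => t fg /fg /= ->.
Qed.

Lemma Lspace_Lfun (p : \bar R) (p1 : (1 <= p)%E) (u : LspaceType mu p1) :
  (u : T -> R) \in Lfun mu p.
Proof.
apply/andP; split; rewrite inE/=; last exact: Lebesgue_finite.
exact: (measurable_funPT (repr (u : {mfun_ mu, T >-> measurableTypeR R}))).
Qed.

(** An element of L^p coerces to a chosen representative of its class, so a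
    function can be recovered from its class only up to a.e. equality. *)
Lemma Lfun_Lspace (r : R) (r1 : (1 <= r%:E)%E) (f : T -> R) :
  f \in Lfun mu r%:E ->
  exists u : LspaceType mu r1, ae_eq mu setT (u : T -> R) f.
Proof.
case/andP; rewrite !inE/= => mf finf.
pose g : {mfun T >-> measurableTypeR R} :=
  HB.pack f (@isMeasurableFun.Build _ _ _ (measurableTypeR R) f mf).
pose v : {mfun_ mu, T >-> measurableTypeR R} :=
  (\pi_({mfun_ mu, T >-> measurableTypeR R}) g)%qT.
have vf : ae_eq mu setT (v : T -> R) f.
  by have := reprK v; rewrite {2}/v => /eqmodP/asboolP; exact.
have finv : finite_norm mu r%:E v.
  apply: (ae_eq_finite_norm mf) finf; first exact: (measurable_funPT (repr v)).
  exact: ae_eq_sym.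
pose u : LspaceType mu r1 := HB.pack v (isFinLebesgue.Build _ _ _ _ _ r1 v finv).
by exists u.
Qed.

End Lfun_closure.

(** * Integrals of a.e. nonnegative functions *)

Section ae_nonneg.
Context d (T : measurableType d) (R : realType).
Context (mu : {measure set T -> \bar R}).

Lemma ae_ge0_Rintegral_norm (D : set T) (f : T -> R) : measurable D ->
  mu.-integrable D (EFin \o f) ->
  (\forall t \ae mu, D t -> 0 <= f t) ->
  \int[mu]_(t in D) f t = \int[mu]_(t in D) `|f t|.
Proof.
move=> mD fi f0; rewrite /Rintegral; congr fine.
have mf := measurable_int _ fi.
apply: ae_eq_integral => //.
  apply/measurable_EFinP; apply: measurableT_comp => //; exact/measurable_EFinP.
by apply: filterS f0 => t f0 /f0 ft; rewrite /= ger0_norm.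
Qed.

Lemma ae_ge0_Rintegral_ge0 (D : set T) (f : T -> R) : measurable D ->
  mu.-integrable D (EFin \o f) ->
  (\forall t \ae mu, D t -> 0 <= f t) ->
  0 <= \int[mu]_(t in D) f t.
Proof.
by move=> mD fi f0; rewrite ae_ge0_Rintegral_norm//; apply: Rintegral_ge0.
Qed.

Lemma ae_ge0_Rintegral_eq0 (D : set T) (f : T -> R) : measurable D ->
  mu.-integrable D (EFin \o f) ->
  (\forall t \ae mu, D t -> 0 <= f t) ->
  \int[mu]_(t in D) f t = 0 ->
  \forall t \ae mu, D t -> f t = 0.
Proof.
move=> mD fi f0; rewrite ae_ge0_Rintegral_norm// => I0.
have mf := measurable_int _ fi.
have : (\int[mu]_(t in D) `|(EFin \o f) t| = 0)%E.
  rewrite -[LHS]fineK; first by rewrite -[RHS]/(0%:E) -I0.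
  exact/integrable_fin_num/integrable_abse.
move/(ae_eq_integral_abs mu mD mf); apply: filterS => t ft Dt.
by have [] := ft Dt.
Qed.

End ae_nonneg.

(** * Restricted measures *)

Section restricted_measure.
Context d (T : measurableType d) (R : realType).
Context (mu : {measure set T -> \bar R}) (D : set T) (mD : measurable D).

Lemma integrable_mrestr (f : T -> \bar R) :
  (mrestr mu mD).-integrable setT f -> mu.-integrable D f.
Proof.
move=> /integrableP[mf foo]; apply/integrableP; split.
  exact: measurable_funTS.
(* on measurable subsets of D both measures agree *)
rewrite (@eq_measure_integral _ _ _ _ (mrestr mu mD)).
  apply: le_lt_trans foo; apply: ge0_subset_integral => //.
  exact: measurableT_comp.
by move=> A mA AD; rewrite /= /mrestr setIidl.
Qed.

Lemma ae_eq_mrestr (U : Type) (f g : T -> U) :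
  ae_eq (mrestr mu mD) setT f g -> ae_eq mu D f g.
Proof.
move=> [N [mN N0 sN]]; exists (N `&` D); split => //.
  exact: measurableI.
move=> t /= /not_implyP[Dt nfg]; split => //; apply: sN => /= fg.
exact/nfg/fg.
Qed.

End restricted_measure.

(** * Sums over the fibers of a map *)

Lemma partition_sum_fibers (R : pzRingType) (W P : finType) (od : P -> W)
    (c : W -> R) (x : P -> R) :
  \sum_w c w * (\sum_(p | od p == w) x p) = \sum_p c (od p) * x p.
Proof.
rewrite (partition_big od xpredT)//=; apply: eq_bigr => w _.
by rewrite mulr_sumr; apply: eq_bigr => p /eqP ->.
Qed.

(** * Square-integrable functions on the time interval *)

Section L2.
Context (R : realType) (t0 tf : R).

Let D : set R := [set` `[t0, tf]].
Local Notation muD := (mrestr (leb R) (measurable_itv `[t0, tf])).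

Lemma L2_Lfun (u : L2 t0 tf) : (u : R -> R) \in Lfun muD 2%:E.
Proof. exact: Lspace_Lfun. Qed.

Lemma L2_cst (c : R) : cst c \in Lfun muD 2%:E.
Proof.
apply: Lfun_cst_fin; rewrite /= /mrestr setTI /= lebesgue_measure_itv.
by case: ifP => // _; rewrite -EFinB ltry.
Qed.

Lemma L2_subcst (u : L2 t0 tf) (c : R) : (fun t => u t - c) \in Lfun muD 2%:E.
Proof. by apply: LfunB; [exact: lee1n|exact: L2_Lfun|exact: L2_cst]. Qed.

Lemma L2_sub (u v : L2 t0 tf) : (fun t => u t - v t) \in Lfun muD 2%:E.
Proof. by apply: LfunB; [exact: lee1n|exact: L2_Lfun|exact: L2_Lfun]. Qed.

Lemma L2_integrableM (f g : R -> R) :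
  f \in Lfun muD 2%:E -> g \in Lfun muD 2%:E ->
  (leb R).-integrable D (EFin \o (fun t => f t * g t)).
Proof.
move=> Lf Lg; have /Lfun1_integrable := Lfun2_mul_Lfun1 Lf Lg.
exact: integrable_mrestr.
Qed.

Lemma L2_integrable (f : R -> R) :
  f \in Lfun muD 2%:E -> (leb R).-integrable D (EFin \o f).
Proof.
move=> Lf; have := L2_integrableM Lf (L2_cst 1).
by congr integrable; apply/funext => t /=; rewrite mulr1.
Qed.

(** The test function of the converse direction must be an element of L^2. *)
Lemma L2_projection_step (g : R -> R) (u : L2 t0 tf) :
  g \in Lfun muD 2%:E ->
  exists v : L2 t0 tf, \forall t \ae leb R, t \in `[t0, tf] ->
    v t = Num.max 0 (u t - g t).
Proof.
move=> Lg.
have Lug : (fun t => u t - g t) \in Lfun muD 2%:E.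
  by apply: LfunB => //; [exact: lee1n|exact: L2_Lfun].
have [v vE] := Lfun_Lspace (lee1n 2) (Lfun_max0 (lee1n 2) Lug).
by exists v; exact: (ae_eq_mrestr vE).
Qed.

Lemma Rintegral_subcst (u v w : L2 t0 tf) (c : R) :
  \int[leb R]_(t in `[t0, tf]) ((u t - c) * (v t - w t)) =
  \int[leb R]_(t in `[t0, tf]) (u t * (v t - w t))
  - c * (\int[leb R]_(t in `[t0, tf]) v t - \int[leb R]_(t in `[t0, tf]) w t).
Proof.
rewrite -RintegralB//; [|exact/L2_integrable/L2_Lfun..].
rewrite -RintegralZl//; last exact: (L2_integrable (L2_sub v w)).
rewrite -RintegralB//; last 2 first.
  exact: (L2_integrableM (L2_Lfun u) (L2_sub v w)).
  exact: (L2_integrableM (L2_cst c) (L2_sub v w)).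
by apply: eq_Rintegral => t _; rewrite mulrBl.
Qed.

(** * Complementarity and the variational inequality *)

(** The demand constraints turn [Q w - Qs w] into a sum of integrals over the
    paths of [w], so each path [p] absorbs the price [theta (od p)] into its
    own cost and [Q] disappears. *)
Lemma vi_gap (W P : finType) (od : P -> W) (psi h hs : P -> L2 t0 tf)
    (theta Q Qs : W -> R) :
  feasible t0 tf od (h, Q) -> feasible t0 tf od (hs, Qs) ->
  \sum_p \int[leb R]_(t in `[t0, tf]) (psi p t * (h p t - hs p t))
    - \sum_w theta w * (Q w - Qs w) =
  \sum_p \int[leb R]_(t in `[t0, tf])
            ((psi p t - theta (od p)) * (h p t - hs p t)).
Proof.
move=> [/= _ hQ] [/= _ hsQs].
under [X in _ - X]eq_bigr => w _ do rewrite -hQ -hsQs -sumrB.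
rewrite partition_sum_fibers -sumrB.
by apply: eq_bigr => p _; rewrite Rintegral_subcst.
Qed.

Lemma vi_of_complementarity (P : finType) (psi h hs : P -> L2 t0 tf)
    (c : P -> R) :
  L2plus t0 tf P h -> L2plus t0 tf P hs ->
  (forall p, \forall t \ae leb R, t \in `[t0, tf] ->
     (0 < hs p t -> psi p t = c p) /\ c p <= psi p t) ->
  0 <= \sum_p \int[leb R]_(t in `[t0, tf])
                 ((psi p t - c p) * (h p t - hs p t)).
Proof.
move=> h0 hs0 due; apply: sumr_ge0 => p _.
apply: ae_ge0_Rintegral_ge0 => //.
  exact: (L2_integrableM (L2_subcst _ _) (L2_sub _ _)).
move: (h0 p) (hs0 p) (due p).
apply: filterS3; first exact: (ae_filter_ringOfSetsType (leb R)).
move=> t h0t hs0t duet tD; have [{}duet le] := duet tD.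
move: (hs0t tD); rewrite le_eqVlt => /orP[/eqP <-|/duet ->]; last first.
  by rewrite subrr mul0r.
by rewrite subr0 mulr_ge0 ?subr_ge0// h0t.
Qed.

(** The inequality is tested at the single rate vector obtained from [hs] by
    projecting [hs p - (psi p - c p)] on the nonnegative functions. *)
Lemma complementarity_of_vi (P : finType) (psi hs : P -> L2 t0 tf)
    (c : P -> R) :
  L2plus t0 tf P hs ->
  (forall h, L2plus t0 tf P h ->
    0 <= \sum_p \int[leb R]_(t in `[t0, tf])
                   ((psi p t - c p) * (h p t - hs p t))) ->
  forall p, \forall t \ae leb R, t \in `[t0, tf] ->
     (0 < hs p t -> psi p t = c p) /\ c p <= psi p t.
Proof.
move=> hs0 vi p.
have [v vE] := L2_projection_step (hs p) (L2_subcst (psi p) (c p)).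
pose h q := if q == p then v else hs q.
have h0 : L2plus t0 tf P h.
  move=> q; rewrite /h; case: eqP => _; last exact: hs0.
  apply: filterS vE; first exact: (ae_filter_ringOfSetsType (leb R)).
  by move=> t vt /vt ->; rewrite le_max lexx.
pose f t := (psi p t - c p) * (hs p t - v t).
have fi : (leb R).-integrable D (EFin \o f).
  exact: (L2_integrableM (L2_subcst _ _) (L2_sub _ _)).
have f0 : \forall t \ae leb R, D t -> 0 <= f t.
  move: (hs0 p) vE.
  apply: filterS2; first exact: (ae_filter_ringOfSetsType (leb R)).
  by move=> t hst vt tD; rewrite /f vt//; exact/projection_step_ge0/hst.
have If0 : \int[leb R]_(t in `[t0, tf]) f t = 0.
  apply/eqP; rewrite eq_le ae_ge0_Rintegral_ge0// andbT.
  rewrite -oppr_ge0 -[X in 0 <= X]mulN1r -RintegralZl//.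
  (* h and hs differ on path p only, so the inequality reduces to that term *)
  have := vi h h0; rewrite (bigD1 p)//= big1 => [|q qp]; last first.
    rewrite /h (negbTE qp); under eq_Rintegral do rewrite subrr mulr0.
    by rewrite Rintegral_cst// mul0r.
  rewrite addr0 /h eqxx; congr (_ <= _).
  by apply: eq_Rintegral => t _; rewrite /f mulN1r -mulrN opprB.
have ae_f0 : \forall t \ae leb R, D t -> f t = 0.
  by apply: ae_ge0_Rintegral_eq0 fi f0 If0; rewrite /D; exact: measurable_itv.
move: ae_f0 (hs0 p) vE.
apply: filterS3; first exact: (ae_filter_ringOfSetsType (leb R)).
move=> t ft hst vt tD.
have [] := @projection_step_eq0 _ (hs p t) (psi p t - c p) (hst tD).
  by rewrite -vt//; exact: ft.
by rewrite subr_ge0 => le eq; split=> // /eq /eqP; rewrite subr_eq0 => /eqP.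
Qed.

End L2.

Theorem theorem3p2 (R : realType) (t0 tf : R) (t0_lt_tf : t0 < tf)
    (W P : finType) (od : P -> W)
    (Psi : {fun L2plus t0 tf P >-> L2plus t0 tf P})
    (Psi_gt0 : forall h Q, feasible t0 tf od (h, Q) -> forall p,
      \forall t \ae leb R, t \in `[t0, tf] -> 0 < Psi h p t)
    (Theta : {fun nneg_vec R W >-> pos_vec R W})
    (V : set (W -> R)) (demand : (W -> R) -> W -> R)
    (Theta_inv : inverse_demand V demand Theta)
    (hs : P -> L2 t0 tf) (Qs : W -> R)
    (hs_feasible : feasible t0 tf od (hs, Qs)) :
  elastic_due od Psi Theta hs Qs <->
  forall (h : P -> L2 t0 tf) (Q : W -> R), feasible t0 tf od (h, Q) ->
    0 <= \sum_(p : P) \int[leb R]_(t in `[t0, tf])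
                        (Psi hs p t * (h p t - hs p t))
         - \sum_(w : W) Theta Qs w * (Q w - Qs w).
Proof.
have hs0 := hs_feasible.1; split=> [due h Q hQ|vi w p <-].
  rewrite (vi_gap _ _ hQ hs_feasible).
  exact: (vi_of_complementarity hQ.1 hs0 (fun p => due _ p erefl)).
apply: (complementarity_of_vi (c := Theta Qs \o od) hs0 _ p) => h h0.
pose Q w := \sum_(p | od p == w) \int[leb R]_(t in `[t0, tf]) h p t.
have hQ : feasible t0 tf od (h, Q) by split.
by rewrite -(vi_gap _ _ hQ hs_feasible); exact: vi.
Qed.
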